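(* There is an absolute constant $\gamma>0$ such that the following holds. Let $n \geq 2^{12}$ and let $d\geq 2$ be even. Let $\mathbb{F}$ be any field and let $C$ be a non-commutative arithmetic circuit with set of input variables $X=\{x_1,\ldots,x_n\}$ over $\mathbb{F}$, computing the non-commutative polynomial $f \in \mathbb{F}\langle X \rangle$. If the matrix $M_f^{d/2,d/2}$ has full rank (i.e. rank $n^{d/2}$), then $C$ contains at least $\gamma\, d\sqrt{n}$ non-scalar product gates.
   Context: $\mathbb{F}\langle X\rangle$ denotes the ring of non-commutative polynomials over $\mathbb{F}$ in the non-commuting variables $x_1,\dots,x_n$: formal $\mathbb{F}$-linear combinations of words over the alphabet $\{x_1,\dots,x_n\}$, with product of words given by concatenation, extended bilinearly. For $f\in\mathbb{F}\langle X\rangle$ and $a,b\in\mathbb{N}$, $M_f^{a,b}$ is the $n^a\times n^b$ matrix whose entry in row $(i_1,\dots,i_a)$ and column $(j_1,\dots,j_b)$ (with all indices in $\{1,\dots,n\}$) is the coefficient of the word $x_{i_1}\cdots x_{i_a}x_{j_1}\cdots x_{j_b}$ in $f$. An arithmetic circuit is a finite directed acyclic graph whose in-degree-0 nodes (leaves) are labeled by an input variable or a field element, whose other nodes are labeled $+$ (sum gates, arbitrary positive in-degree) or $\times$ (product gates, in-degree exactly 2, with an ordered left child and right child), and with a designated output node (the unique node of out-degree 0). In a non-commutative circuit each node computes an element of $\mathbb{F}\langle X\rangle$: a leaf computes its label, a sum gate the sum of its children's polynomials, and a product gate the product (left child's polynomial times right child's polynomial, in that order); the circuit computes the polynomial at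 the output node. A product gate is non-scalar if the polynomials computed by both of its children have degree at least 1. *)

(* Defs.v *)
From mathcomp Require Import all_boot all_order all_algebra.
From mathcomp Require Import monalg.

Set Implicit Arguments.
Unset Strict Implicit.
Unset Printing Implicit Defensive.

Import GRing.Theory.
Local Open Scope ring_scope.

(* The monoid algebra over F of the free monoid on 'I_n, i.e. F<x_1, ..., x_n>. *)
Notation ncpoly F n := {malg F[{fmonom 'I_n}]}.

Section NCPoly.
Variables (F : fieldType) (n : nat).

Definition nccoef (f : ncpoly F n) (w : seq 'I_n) : F :=
  mcoeff (FMonom w) f.

Definition ncvar (i : 'I_n) : ncpoly F n := mkmalgU (fmu i) 1.

Definition ncconst (c : F) : ncpoly F n := malgC c.

(* [mmeasure] is the degree plus one, and 0 for the zero polynomial; thus the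
   zero polynomial gets degree 0 here. *)
Definition ncdeg (f : ncpoly F n) : nat :=
  (mmeasure (fdeg (I:='I_n)) f).-1.

Lemma card_words (a : nat) : (n ^ a)%N = #|{: a.-tuple 'I_n}|.
Proof. by rewrite card_tuple card_ord. Qed.

(* A bijection between 'I_(n ^ a) and the words of length a. *)
Definition index_word (a : nat) (k : 'I_(n ^ a)) : a.-tuple 'I_n :=
  enum_val (cast_ord (card_words a) k).

Lemma index_word_bij (a : nat) : bijective (@index_word a).
Proof.
exists (fun w => cast_ord (esym (card_words a)) (enum_rank w)) => x.
  by rewrite /index_word enum_valK cast_ordK.
by rewrite /index_word cast_ordKV enum_rankK.
Qed.

Definition coef_matrix (f : ncpoly F n) (a b : nat) : 'M[F]_(n ^ a, n ^ b) :=
  \matrix_(i, j) nccoef f (index_word i ++ index_word j).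

End NCPoly.

(* A gate carries the tails of its incoming edges.  Parallel edges are allowed:
   a product gate computing a square has the same node as both children. *)
Inductive gate (F : fieldType) (n : nat) (V : Type) : Type :=
| Input of 'I_n
| Scalar of F
| Sum of seq V
| Product of V & V.

Definition children (F : fieldType) (n : nat) (V : Type) (g : gate F n V) :
    seq V :=
  match g with
  | Input _ | Scalar _ => [::]
  | Sum s => s
  | Product l r => [:: l; r]
  end.

Record circuit (F : fieldType) (n : nat) := Circuit {
  node : finType;
  label : node -> gate F n node;
  output : node;
  circuit_acyclic : forall p : seq node,
    cycle (fun u v => u \in children (label v)) p -> p = [::];
  circuit_sum_indegree : forall v s, label v = Sum F n s -> s != [::];
  circuit_output : forall u,
    (forall v, u \notin children (label v)) <-> u = output
}.

Section Semantics.
Variables (F : fieldType) (n : nat) (C : circuit F n).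

(* Evaluation with recursion depth at most k; by acyclicity the number of nodes
   is always enough, and node_polyE gives the defining equations. *)
Fixpoint eval_depth (k : nat) (v : node C) : ncpoly F n :=
  if k is k'.+1 then
    match label v with
    | Input i => ncvar F i
    | Scalar c => ncconst n c
    | Sum s => \sum_(u <- s) eval_depth k' u
    | Product l r => eval_depth k' l * eval_depth k' r
    end
  else 0.

Definition node_poly (v : node C) : ncpoly F n := eval_depth #|node C| v.

Definition circuit_poly : ncpoly F n := node_poly (output C).

Definition nonscalar_product (v : node C) : bool :=
  if label v is Product l r then
    (1 <= ncdeg (node_poly l))%N && (1 <= ncdeg (node_poly r))%N
  else false.

Definition nonscalar_size : nat := #|[set v | nonscalar_product v]|.

Let down : rel (node C) := fun v u => u \in children (label v).

Let down_uniq v p : path down v p -> uniq (v :: p).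
Proof.
elim: p v => [|u p IH] v //= /andP[vu pu].
rewrite -[_ && uniq p]/(uniq (u :: p)) IH // andbT.
apply/negP => v_up.
have pv : path down v (u :: p) by rewrite /= vu.
case/splitPr: v_up pv => p1 p2; rewrite cat_path /= => /and3P[p1v lv _].
have cyc : cycle down (v :: p1) by rewrite /= rcons_path p1v.
by have := @circuit_acyclic _ _ C (rev (v :: p1));
   rewrite rev_cycle => /(_ cyc)/(congr1 size); rewrite size_rev.
Qed.

Let eval_depth_stable k k' v :
    (forall p, path down v p -> (size p < k)%N) ->
    (forall p, path down v p -> (size p < k')%N) ->
  eval_depth k v = eval_depth k' v.
Proof.
elim: k k' v => [|k IH] k' v hk hk'; first by have := hk [::] isT.
case: k' hk' => [|k'] hk'; first by have := hk' [::] isT.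
have eqc u : u \in children (label v) -> eval_depth k u = eval_depth k' u.
  move=> uv; apply: IH => p pu.
  - by apply: (hk (u :: p)); rewrite /= pu andbT.
  - by apply: (hk' (u :: p)); rewrite /= pu andbT.
rewrite [LHS]/= [RHS]/=; case: (label v) eqc => [i|c|s|l r] eqc.
- by [].
- by [].
- by apply: eq_big_seq => u us; apply: eqc.
- by congr (_ * _); apply: eqc; rewrite !inE eqxx ?orbT.
Qed.

Lemma node_polyE v : node_poly v =
  match label v with
  | Input i => ncvar F i
  | Scalar c => ncconst n c
  | Sum s => \sum_(u <- s) node_poly u
  | Product l r => node_poly l * node_poly r
  end.
Proof.
have short u p : path down u p -> (size p < #|node C|)%N.
  by move=> /down_uniq/card_uniqP/= <-; apply: max_card.
rewrite {1}/node_poly (@eval_depth_stable _ #|node C|.+1).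
- by [].
- exact: short.
- by move=> p /short /ltnW.
Qed.

End Semantics.

(* Main.v *)
Require Import Defs.
From mathcomp Require Import all_boot all_order all_algebra finmap monalg reals.
From mathcomp Require Import zify.
From Stdlib Require List.

(** Subtracting constant terms, the s non-scalar products become a straight-line
    program P_k = A_k B_k in which A_k and B_k have no constant term and are
    linear combinations of the variables and of P_1, ..., P_(k-1).  To read off
    the coefficient of u v in P_k, with |u| = a and |v| = b, split u v between
    A_k and B_k.  If the split falls inside u, a component of A_k of some degree
    i > 0 is peeled off u and one continues with B_k, where u has lost i letters;
    if it falls inside v, a component of B_k is peeled off v and one continues
    with A_k.  The indices k decrease, so once u or v is exhausted it has been
    matched against a product of homogeneous components
    A_(k_1)^(i_1) ... A_(k_p)^(i_p) with k_1 > ... > k_p and i_1 + ... + i_p = a,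
    or against the mirror product of components of the B_k.  There are
    'C(s + a - 1, a) such products for u, so full rank n^a with a = b = d/2
    forces n^a <= 2 'C(s + a - 1, a), whence s is at least of order a n. *)

Set Implicit Arguments.
Unset Strict Implicit.
Unset Printing Implicit Defensive.

Import Order.TTheory GRing.Theory Num.Theory.
Local Open Scope ring_scope.

(** * Coefficients of products, and polynomials of degree 0 *)

Section Coefficients.
Variables (F : fieldType) (n : nat).
Implicit Types (f g : ncpoly F n) (w : seq 'I_n).

Lemma nccoefD f g w : nccoef (f + g) w = nccoef f w + nccoef g w.
Proof. exact: mcoeffD. Qed.

Lemma nccoefZ c f w : nccoef (c *: f) w = c * nccoef f w.
Proof. exact: mcoeffZ. Qed.

Lemma nccoef0 w : nccoef (0 : ncpoly F n) w = 0.
Proof. exact: mcoeff0. Qed.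

Lemma nccoef_var i w : nccoef (ncvar F i) w = (w == [:: i])%:R.
Proof. by rewrite /nccoef mcoeffU fmuE -val_eqE /= eq_sym. Qed.

Lemma nccoefM f g w :
  nccoef (f * g) w =
    \sum_(i < (size w).+1) nccoef f (take i w) * nccoef g (drop i w).
Proof.
have coefE (h : ncpoly F n) x :
    nccoef h x = \sum_(k <- msupp h) h@_k *+ (k == FMonom x).
  rewrite /nccoef [X in mcoeff _ X = _]monalgE raddf_sum /=.
  by apply: eq_bigr => k _; rewrite mcoeffU.
rewrite /nccoef mcoeffMl.
under [RHS]eq_bigr => i _ do rewrite -!/(nccoef _ _) !coefE big_distrlr /=.
rewrite [RHS]exchange_big /=; apply: eq_bigr => k1 _.
rewrite [RHS]exchange_big /=; apply: eq_bigr => k2 _.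
have [k12|k12] := eqVneq (mmul k1 k2) (FMonom w); last first.
  rewrite big1 // => i _.
  have [e1|] := eqVneq k1 (FMonom (take i w)); last by rewrite mulr0n mul0r.
  have [e2|] := eqVneq k2 (FMonom (drop i w)); last by rewrite mulr0n mulr0.
  by case/eqP: k12; apply: val_inj; rewrite /= fmM e1 e2 /= cat_take_drop.
have {k12} -> : w = k1 ++ k2 by rewrite -fmM k12.
(* Of all cuts of [k1 ++ k2], only the one at the length of [k1] yields the pair [k1], [k2]. *)
have lt1 : (size k1 < (size (k1 ++ k2)).+1)%N.
  by rewrite size_cat ltnS leq_addr.
rewrite (bigD1 (Ordinal lt1)) //= take_size_cat // drop_size_cat //.
rewrite !fmK !eqxx big1 ?addr0 // => i neq_i.
have [e1|] := eqVneq k1 _; last by rewrite mulr0n mul0r.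
case/eqP: neq_i; apply: val_inj => /=.
have := congr1 (fun m : {fmonom 'I_n} => size m) e1.
rewrite /= size_take => ->; have := ltn_ord i.
rewrite ltnS => le_i; case: ltnP => // ge_i.
by apply/eqP; rewrite eqn_leq le_i ge_i.
Qed.

Lemma ncconstM c f : ncconst n c * f = c *: f.
Proof. exact: mul_malgC. Qed.

Lemma mulr_ncconst f c : f * ncconst n c = c *: f.
Proof.
rewrite malgM_def fgmulgU malgZ_def; apply: eq_bigr => k _.
by rewrite mulrC mulm1.
Qed.

(** Makes scalar product gates free: one factor is a constant, possibly zero, so the gate only
    rescales the other. *)
Lemma ncdeg0P f : (ncdeg f < 1)%N -> exists c, f = ncconst n c.
Proof.
rewrite ltnS leqn0 /ncdeg => /eqP deg0.
exists (mcoeff mone f); apply/malgP => k; rewrite mcoeffC.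
have [->|k1] := eqVneq k mone; first by [].
rewrite mulr0n; apply: mcoeff_outdom; apply/negP => kf.
have lt : (fdeg k < mmeasure (fdeg (I:='I_n)) f)%N by apply: mmeasure_mnm_lt.
have : (0 < fdeg k)%N by rewrite lt0n fdeg_eq0.
by move: deg0 lt; move: (mmeasure _ f) (fdeg k) => m e; lia.
Qed.

End Coefficients.

(** * Rank of bilinear decompositions and the number of chains *)

Section Decomposition.
Variables (F : fieldType) (n : nat).
Local Notation word := (seq 'I_n).
Implicit Types (L R : seq (word -> F)) (G : word -> word -> F) (a b : nat).

(* The members of R are evaluated at the reversed right word: this way the
   factors peeled off from the right form a [chain] too. *)
Inductive decomp L R a b : (word -> word -> F) -> Prop :=
| decomp_zero G :
    (forall u v, size u = a -> size v = b -> G u v = 0) -> decomp L R a b G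
| decomp_left l h G G' : List.In l L -> decomp L R a b G' ->
    (forall u v, size u = a -> size v = b -> G u v = l u * h v + G' u v) ->
    decomp L R a b G
| decomp_right r h G G' : List.In r R -> decomp L R a b G' ->
    (forall u v, size u = a -> size v = b ->
       G u v = h u * r (rev v) + G' u v) ->
    decomp L R a b G.

Lemma decomp_ext L R a b G G' :
    (forall u v, size u = a -> size v = b -> G u v = G' u v) ->
  decomp L R a b G' -> decomp L R a b G.
Proof.
move=> eqG decG.
case: decG eqG => [H H0|l h H H' lL decH' HE|r h H H' rR decH' HE] eqG.
- by apply: decomp_zero => u v su sv; rewrite eqG // H0.
- by apply: (decomp_left (h := h) lL decH') => u v su sv; rewrite eqG // HE.
- by apply: (decomp_right (h := h) rR decH') => u v su sv; rewrite eqG // HE.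
Qed.

Lemma decompD L R a b G G' : decomp L R a b G -> decomp L R a b G' ->
  decomp L R a b (fun u v => G u v + G' u v).
Proof.
move=> decG decG'.
elim: decG => {G} [G G0|l h G H lL _ IH GE|r h G H rR _ IH GE].
- by apply: decomp_ext decG' => u v su sv; rewrite G0 // add0r.
- by apply: (decomp_left (h := h) lL IH) => u v su sv; rewrite GE // addrA.
- by apply: (decomp_right (h := h) rR IH) => u v su sv; rewrite GE // addrA.
Qed.

Lemma decompZ L R a b c G :
  decomp L R a b G -> decomp L R a b (fun u v => c * G u v).
Proof.
elim=> {G} [G G0|l h G H lL _ IH GE|r h G H rR _ IH GE].
- by apply: decomp_zero => u v su sv; rewrite G0 // mulr0.
- apply: (decomp_left (h := fun v => c * h v) lL IH) => u v su sv.
  by rewrite GE // mulrDr mulrCA.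
- apply: (decomp_right (h := fun u => c * h u) rR IH) => u v su sv.
  by rewrite GE // mulrDr mulrA.
Qed.

Lemma decomp_sum L R a b m (G : nat -> word -> word -> F) :
    (forall i, (i < m)%N -> decomp L R a b (G i)) ->
  decomp L R a b (fun u v => \sum_(i < m) G i u v).
Proof.
elim: m => [|m IH] decG.
  by apply: decomp_zero => u v _ _; rewrite big_ord0.
apply: decomp_ext (decompD (IH _) (decG m _)) => // [u v _ _|i lt_im].
  by rewrite big_ord_recr.
by apply: decG; apply: ltnW.
Qed.

Lemma decompS L L' R R' a b G :
    (forall l, List.In l L -> List.In l L') ->
    (forall r, List.In r R -> List.In r R') ->
  decomp L R a b G -> decomp L' R' a b G.
Proof.
move=> sL sR; elim=> {G} [G G0|l h G H lL _ IH GE|r h G H rR _ IH GE].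
- exact: decomp_zero.
- by apply: decomp_left IH GE; apply: sL.
- by apply: decomp_right IH GE; apply: sR.
Qed.

(** Terms with the same [l], or the same [r], merge: [L] provides the columns of a left factor and
    [R] the rows of a right factor, so the bound does not grow with the number of terms. *)
Lemma decomp_rank L R a b (G : word -> word -> F) : decomp L R a b G ->
  (\rank (\matrix_(i < n ^ a, j < n ^ b) G (index_word i) (index_word j))
     <= size L + size R)%N.
Proof.
have InP (T : Type) (x0 x : T) (s : seq T) :
    List.In x s -> exists i : 'I_(size s), nth x0 s i = x.
  elim: s => //= y s IH [->|/IH[i <-]]; first by exists ord0.
  by exists (lift ord0 i); rewrite lift0.
pose z : word -> F := fun=> 0.
pose ML := \matrix_(i < n ^ a, k < size L) nth z L k (index_word i).
pose MR :=
  \matrix_(k < size R, j < n ^ b) nth z R k (rev (index_word j)).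
move=> decG.
suff [X [Y ->]] : exists X Y,
    \matrix_(i, j) G (index_word i) (index_word j) = ML *m X + Y *m MR.
  apply: leq_trans (mxrank_add _ _) (leq_add _ _).
    exact: leq_trans (mxrankM_maxl _ _) (rank_leq_col _).
  exact: leq_trans (mxrankM_maxr _ _) (rank_leq_row _).
elim: decG => {G} [G G0|l h G H lL _ [X [Y HE]] GE|r h G H rR _ [X [Y HE]] GE].
- exists 0, 0; rewrite mulmx0 mul0mx addr0; apply/matrixP => i j.
  by rewrite !mxE G0 ?size_tuple.
- have [k lE] := InP _ z _ _ lL.
  (* The term [l u * h v] adds [h] to the row of [X] that faces the column of [l]. *)
  exists (delta_mx k (ord0 : 'I_1) *m (\row_j h (index_word j)) + X), Y.
  rewrite mulmxDr -addrA -HE mulmxA -colE; apply/matrixP => i j.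
  by rewrite !mxE big_ord1 !mxE lE GE ?size_tuple.
- have [k rE] := InP _ z _ _ rR.
  exists X, ((\col_i h (index_word i)) *m delta_mx (ord0 : 'I_1) k + Y).
  rewrite mulmxDl addrCA -HE -mulmxA -rowE; apply/matrixP => i j.
  by rewrite !mxE big_ord1 !mxE rE GE ?size_tuple.
Qed.

(* The head of [cs] stands for the last gate, so each member multiplies
   components of positive degree of a subsequence of [cs], of total degree [a]. *)
Fixpoint chain (cs : seq (word -> F)) a : seq (word -> F) :=
  if cs is c :: cs' then
    chain cs' a ++
    flatten [seq [seq (fun w => c (take i w) * l (drop i w))
                 | l <- chain cs' (a - i)%N] | i <- iota 1 a]
  else if a is 0%N then [:: fun=> 1] else [::].

(* 'C(s + a - 1, a) <= x^-a (1 - x)^-s at x = 1 / (m + 1), where s = size cs. *)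
Lemma size_chain m cs a :
  (size (chain cs a) * m ^ size cs <= m.+1 ^ (a + size cs))%N.
Proof.
elim: cs a => [|c cs IH] a.
  by case: a => [|a] //=; rewrite mul0n.
(* Hockey-stick recursion: [c] takes a degree from 0 to [a], where degree 0 means that [c] is
   skipped. *)
have -> : size (chain (c :: cs) a) = (\sum_(i < a.+1) size (chain cs i))%N.
  rewrite /= size_cat size_flatten sumnE /shape -!map_comp big_map.
  rewrite big_ord_recr /= addnC; congr (_ + _)%N.
  rewrite -[1%N]/(1 + 0)%N iotaDl big_map.
  rewrite -[in iota 0 a](subn0 a) -/(index_iota 0 a).
  rewrite big_mkord (reindex_inj rev_ord_inj) /=.
  apply: eq_bigr => i _; rewrite size_map; congr (size (chain _ _)).
  by have := ltn_ord i; lia.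
(* Geometric sum of ratio [m.+1], multiplied by the ratio minus one. *)
have geo : (m * \sum_(i < a.+1) m.+1 ^ i <= m.+1 ^ a.+1)%N.
  elim: a.+1 => [|k IHk]; first by rewrite big_ord0 muln0.
  by rewrite big_ord_recr /= mulnDr (expnS _ k) mulSn leq_add2r.
rewrite [size (_ :: _)]/= expnS addnS -addSn expnD mulnCA.
apply: leq_trans (leq_mul geo (leqnn _)).
rewrite -mulnA leq_mul2l !big_distrl /=; apply/orP; right.
by apply: leq_sum => i _; rewrite -expnD.
Qed.

End Decomposition.

(** * Straight-line programs without constant terms *)

Section StraightLine.
Variables (F : fieldType) (n : nat).
Implicit Types (f g : ncpoly F n) (ps : seq (ncpoly F n * ncpoly F n)).

Inductive generated ps : ncpoly F n -> Prop :=
| gen_zero : generated ps 0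
| gen_var i : generated ps (ncvar F i)
| gen_prod p : p \in ps -> generated ps (p.1 * p.2)
| gen_lin c f g : generated ps f -> generated ps g -> generated ps (c *: f + g).

(** The last product is at the head, so that induction removes it first, in step with the recursion
    of [chain]. *)
Fixpoint straight_line ps : Prop :=
  if ps is p :: ps' then
    [/\ generated ps' p.1, generated ps' p.2 & straight_line ps']
  else True.

Lemma genS ps ps' f : {subset ps <= ps'} -> generated ps f -> generated ps' f.
Proof.
move=> sub; elim=> [|i|p /sub|c g h _ gh _ gg].
- exact: gen_zero.
- exact: gen_var.
- exact: gen_prod.
- exact: gen_lin.
Qed.

Lemma genD ps f g : generated ps f -> generated ps g -> generated ps (f + g).
Proof. by move=> gf gg; rewrite -[f]scale1r; apply: gen_lin. Qed.

Lemma genZ ps c f : generated ps f -> generated ps (c *: f).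
Proof.
by move=> gf; rewrite -[_ *: _]addr0; apply: gen_lin gf (gen_zero _).
Qed.

(** This excludes the cuts that leave one factor the empty word, so every component peeled off has
    positive degree. *)
Lemma gen_coef0 ps f : straight_line ps -> generated ps f -> nccoef f [::] = 0.
Proof.
elim: ps f => [|p ps IH] f /=.
  move=> _; elim=> [|i|//|c g h _ g0 _ h0]; rewrite ?nccoef0 ?nccoef_var //.
  by rewrite nccoefD nccoefZ g0 h0 mulr0 addr0.
move=> [gp1 _ sl]; elim=> [|i|q|c g h _ g0 _ h0].
- by rewrite nccoef0.
- by rewrite nccoef_var.
- rewrite inE => /predU1P[->|/gen_prod]; last exact: IH.
  by rewrite nccoefM big_ord1 (IH _ sl gp1) mul0r.
- by rewrite nccoefD nccoefZ g0 h0 mulr0 addr0.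
Qed.

Definition left_chains ps a := chain [seq nccoef p.1 | p <- ps] a.

(** Peeling a suffix of the right word is peeling a prefix of its reversal; the inner [rev] restores
    the order in which [p.2] reads it. *)
Definition right_chains ps b :=
  chain [seq (fun w => nccoef p.2 (rev w)) | p <- ps] b.

Lemma chain0_one (cs : seq (seq 'I_n -> F)) : List.In (fun=> 1) (chain cs 0).
Proof.
elim: cs => [|c cs IH] /=; first by left.
by apply: List.in_or_app; left.
Qed.

Lemma chain_tail (c : seq 'I_n -> F) cs a l :
  List.In l (chain cs a) -> List.In l (chain (c :: cs) a).
Proof. by move=> lin; apply: List.in_or_app; left. Qed.

Lemma chain_cons (c : seq 'I_n -> F) cs a i l :
    (0 < i <= a)%N -> List.In l (chain cs (a - i)) ->
  List.In (fun w => c (take i w) * l (drop i w)) (chain (c :: cs) a).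
Proof.
move=> i_a lin; apply: List.in_or_app; right.
have : i \in iota 1 a by rewrite mem_iota; lia.
elim: (iota 1 a) => //= j s IH; rewrite inE => /predU1P[<-|/IH ins].
  apply: List.in_or_app; left.
  by have := List.in_map (fun l w => c (take i w) * l (drop i w)) _ _ lin.
by apply: List.in_or_app; right.
Qed.

Lemma generated_decomp ps f a b : straight_line ps -> generated ps f ->
  decomp (left_chains ps a) (right_chains ps b) a b
    (fun u v => nccoef f (u ++ v)).
Proof.
elim: ps f a b => [|p ps IH] f a b.
  move=> _; elim=> [|i|//|c g h _ dg _ dh].
  - by apply: decomp_zero => u v _ _; rewrite nccoef0.
  (* If [a] or [b] is 0, the coefficient itself is the free factor [h], paired with the constant
     chain 1; otherwise the word has at least two letters. *)
  - case: a b => [|a] [|b].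
    + apply: (decomp_left (h := nccoef (ncvar F i)) (chain0_one _)
        (decomp_zero _ _ (G := fun _ _ => 0) _)) => // u v /size0nil -> _.
      by rewrite mul1r addr0.
    + apply: (decomp_left (h := nccoef (ncvar F i)) (chain0_one _)
        (decomp_zero _ _ (G := fun _ _ => 0) _)) => // u v /size0nil -> _.
      by rewrite mul1r addr0.
    + apply: (decomp_right (h := nccoef (ncvar F i)) (chain0_one _)
        (decomp_zero _ _ (G := fun _ _ => 0) _)) => // u v _ /size0nil ->.
      by rewrite mulr1 addr0 cats0.
    + apply: decomp_zero => [[|x u]] // [|y v] // _ _; rewrite nccoef_var.
      by case: eqP => // [[_]] /(congr1 size); rewrite size_cat addnS.
  - apply: decomp_ext (decompD (decompZ c dg) dh) => u v _ _.
    by rewrite nccoefD nccoefZ.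
move=> [gp1 gp2 sl].
have widen g : generated ps g -> decomp (left_chains (p :: ps) a)
    (right_chains (p :: ps) b) a b (fun u v => nccoef g (u ++ v)).
  move=> gg; apply: decompS (IH g a b sl gg) => l; exact: chain_tail.
elim=> [|i|q|c g h _ dg _ dh].
- by apply: widen; apply: gen_zero.
- by apply: widen; apply: gen_var.
- rewrite inE => /predU1P[{q}->|/gen_prod]; last exact: widen.
  apply: (@decomp_ext _ _ _ _ _ _ _ (fun u v => \sum_(i < (a + b).+1)
      nccoef p.1 (take i (u ++ v)) * nccoef p.2 (drop i (u ++ v)))).
    by move=> u v su sv; rewrite nccoefM size_cat su sv.
  apply: (@decomp_sum _ _ _ _ _ _ _ (fun i u v =>
      nccoef p.1 (take i (u ++ v)) * nccoef p.2 (drop i (u ++ v)))) => i lt_i.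
  have [->|i_gt0] := posnP i.
    apply: decomp_zero => u v _ _.
    by rewrite take0 (gen_coef0 sl gp1) mul0r.
  (* Cut inside [u]: [p.1] reads the first [i] letters, and the induction hypothesis for [p.2]
     applies with [a - i]. *)
  have [le_ia|lt_ai] := leqP i a.
    pose G u v := nccoef p.2 (u ++ v).
    apply: (@decomp_ext _ _ _ _ _ _ _ (fun u v =>
        nccoef p.1 (take i u) * G (drop i u) v)).
      move=> u v su sv; rewrite /G takel_cat ?su // drop_cat su.
      case: ltnP => // le_ai.
      have ->: i = a by lia.
      by rewrite subnn drop0 drop_oversize ?su.
    have : decomp (left_chains ps (a - i)) (right_chains ps b) (a - i) b G.
      exact: IH.
    (* The new factor depends on [u] only: it lengthens the left chains and is absorbed by the free
       factor [h] of the right ones. *)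
    elim: {G}_ / => [K K0|l h K H lL _ dH KE|r h K H rR _ dH KE].
    + apply: decomp_zero => u v su sv; rewrite K0 ?mulr0 //.
      by rewrite size_drop su.
    + apply: (decomp_left (h := h) _ dH).
        by apply: (@chain_cons (nccoef p.1)) lL; lia.
      by move=> u v su sv; rewrite KE ?size_drop ?su // mulrDr mulrA.
    + apply: (decomp_right (h := fun u => nccoef p.1 (take i u) * h (drop i u))
        _ dH); first exact: chain_tail rR.
      by move=> u v su sv; rewrite KE ?size_drop ?su // mulrDr mulrA.
  (* Cut inside [v], after [j] letters: the mirror situation, with the induction hypothesis applied
     to [p.1]. *)
  pose j := (i - a)%N.
  pose G u v := nccoef p.1 (u ++ v).
  apply: (@decomp_ext _ _ _ _ _ _ _ (fun u v =>
      G u (take j v) * nccoef p.2 (drop j v))).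
    move=> u v su sv; rewrite /G take_cat drop_cat su.
    by case: ltnP => //; lia.
  have : decomp (left_chains ps a) (right_chains ps j) a j G by exact: IH.
  elim: {G}_ / => [K K0|l h K H lL _ dH KE|r h K H rR _ dH KE].
  + apply: decomp_zero => u v su sv; rewrite K0 ?mul0r //.
    by rewrite size_takel // sv; lia.
  + apply: (decomp_left
      (h := fun v => h (take j v) * nccoef p.2 (drop j v)) _ dH).
      exact: chain_tail lL.
    move=> u v su sv; rewrite KE ?mulrDl ?mulrA // size_takel // sv; lia.
  (* A chain grows only by positive degrees; for [j = b] the factor [p.2] reads the empty word and
     vanishes. *)
  + have [eq_jb|neq_jb] := eqVneq j b.
      apply: decomp_zero => u v su sv.
      by rewrite drop_oversize ?eq_jb ?sv // (gen_coef0 sl gp2) mulr0.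
    (* On [w = rev v], the first [b - j] letters reversed are the last [b - j] letters of [v]. *)
    apply: (decomp_right (h := h) (r := fun w =>
      nccoef p.2 (rev (take (b - j) w)) * r (drop (b - j) w)) _ dH).
      rewrite /right_chains /=.
      apply: (@chain_cons (fun w => nccoef p.2 (rev w))); first lia.
      by have -> : (b - (b - j))%N = j by lia.
    move=> u v su sv; rewrite KE ?size_takel ?sv //; last by lia.
    rewrite mulrDl take_rev drop_rev revK sv.
    have -> : (b - (b - j))%N = j by lia.
    by rewrite -mulrA [r _ * _]mulrC.
- apply: decomp_ext (decompD (decompZ c dg) dh) => u v _ _.
  by rewrite nccoefD nccoefZ.
Qed.

End StraightLine.

(** * From circuits to straight-line programs *)

Section Circuits.
Variables (F : fieldType) (n : nat) (C : circuit F n).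
Local Notation down := (fun v u : node C => u \in children (label v)).

Definition reach_size (v : node C) : nat := #|connect down v|.

Lemma reach_size_child v u :
  u \in children (label v) -> (reach_size u < reach_size v)%N.
Proof.
move=> uv; apply: proper_card; apply/properP; split.
  by apply/subsetP => w; apply: connect_trans; apply: connect1.
exists v; first exact: connect0.
apply/negP => /connectP[p pth vE].
have cyc : cycle down (u :: p) by rewrite /= rcons_path pth -vE.
by have := @circuit_acyclic _ _ C (rev (u :: p));
   rewrite rev_cycle => /(_ cyc)/(congr1 size); rewrite size_rev.
Qed.

Fixpoint topological (s : seq (node C)) : Prop :=
  if s is v :: s' then {subset children (label v) <= s'} /\ topological s'
  else True.

(** Sort by decreasing [reach_size]: acyclicity makes it drop strictly from a gate to its children,
    which therefore come later in the list. *)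
Lemma topological_enum : exists s, topological s /\ perm_eq s (enum (node C)).
Proof.
pose e := relpre reach_size geq.
have e_total : total e by move=> u v; apply: leq_total.
have e_trans : transitive e by move=> u v w /= vu uw; apply: leq_trans uw vu.
exists (sort e (enum (node C))); split; last by rewrite perm_sort.
have := sort_sorted e_total (enum (node C)).
have : forall v u, v \in sort e (enum (node C)) ->
    u \in children (label v) -> u \in sort e (enum (node C)).
  by move=> v u _ _; rewrite mem_sort mem_enum.
elim: (sort _ _) => //= v s IH closed pth.
have v_max w : w \in s -> (reach_size w <= reach_size v)%N.
  by move: w; apply/allP; apply: order_path_min pth.
split=> [u uv|].
  have := closed v u (mem_head _ _) uv; rewrite inE => /predU1P[uE|//].
  by have := reach_size_child uv; rewrite uE ltnn.
apply: IH; last exact: path_sorted pth.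
move=> w u ws uw.
have := closed w u _ uw; rewrite !inE ws orbT => /(_ isT)/predU1P[uE|//].
by have := leq_trans (reach_size_child uw) (v_max w ws); rewrite uE ltnn.
Qed.

Definition generated_mod_const ps (f : ncpoly F n) :=
  exists2 g, generated ps g & exists c, f = ncconst n c + g.

Lemma gen_mod_constD ps f g : generated_mod_const ps f ->
  generated_mod_const ps g -> generated_mod_const ps (f + g).
Proof.
move=> [f' gf [c ->]] [g' gg [e ->]]; exists (f' + g'); first exact: genD.
by exists (c + e); rewrite /ncconst monalgUD addrACA.
Qed.

Lemma gen_mod_constZ ps k f :
  generated_mod_const ps f -> generated_mod_const ps (k *: f).
Proof.
move=> [f' gf [c ->]]; exists (k *: f'); first exact: genZ.
by exists (k * c); rewrite scalerDr -(ncconstM k (ncconst n c)) /ncconst mpolyCM.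
Qed.

(** Expand [(c + l') * (e + r')]: apart from the constant and linear terms, [l' * r'] is the only
    new product. *)
Lemma gen_mod_const_prod ps l r :
    generated_mod_const ps l -> generated_mod_const ps r ->
  exists2 p, generated ps p.1 /\ generated ps p.2 &
    generated_mod_const (p :: ps) (l * r).
Proof.
move=> [l' gl [c ->]] [r' gr [e ->]]; exists (l', r') => //.
have sub : {subset ps <= (l', r') :: ps} by move=> q; rewrite inE orbC => ->.
exists (l' * r' + (c *: r' + e *: l')).
  apply: genD; first exact: (gen_prod (p := (l', r'))) (mem_head _ _).
  by apply: genD; apply: genZ; apply: genS sub _.
exists (c * e).
rewrite mulrDl !mulrDr (ncconstM c r') (mulr_ncconst l') /ncconst mpolyCM.
by rewrite -addrA; congr (_ + _); rewrite [RHS]addrC -addrA.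
Qed.

(** Going through the gates in topological order, only a non-scalar product adds a pair; all other
    gates are linear up to constants. *)
Lemma straight_line_circuit : exists2 ps : seq (ncpoly F n * ncpoly F n),
  straight_line ps & size ps = nonscalar_size C /\
    forall v : node C, generated_mod_const ps (node_poly v).
Proof.
have [s [top_s perm_s]] := topological_enum.
suff [ps sl [szE gen]] : exists2 ps : seq (ncpoly F n * ncpoly F n),
    straight_line ps & size ps = count (@nonscalar_product F n C) s /\
      forall v, v \in s -> generated_mod_const ps (node_poly v).
  exists ps => //; split=> [|v]; last first.
    by apply: gen; rewrite (perm_mem perm_s) mem_enum.
  rewrite szE (permP perm_s) /nonscalar_size cardsE cardE -size_filter.
  by rewrite enumT; congr size; apply: eq_filter.
elim: s top_s {perm_s} => [|v s IH] /=; first by exists [::].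
move=> [child /IH{IH}[ps sl [szE gen]]].
have extend ps' : {subset ps <= ps'} ->
    generated_mod_const ps' (node_poly v) ->
    forall u, u \in v :: s -> generated_mod_const ps' (node_poly u).
  move=> sub gv u; rewrite inE => /predU1P[->//|/gen[g gg gE]].
  by exists g => //; apply: genS gg.
have [nsv|sv] := boolP (nonscalar_product v); last first.
  exists ps => //; split=> //; apply: extend => //.
  rewrite node_polyE; move: sv child; rewrite /nonscalar_product.
  case: (label v) => [i|c|t|l r] /=.
  - move=> _ _; exists (ncvar F i); first exact: gen_var.
    by exists 0; rewrite /ncconst malgC0E add0r.
  - by move=> _ _; exists 0; [exact: gen_zero|exists c; rewrite addr0].
  - move=> _ sub; rewrite big_seq; elim/big_rec: _ => [|u f ut gf].
      exists 0; first exact: gen_zero.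
      by exists 0; rewrite /ncconst malgC0E addr0.
    by apply: gen_mod_constD gf; apply: gen; apply: sub.
  - have := gen l; have := gen r => gr gl.
    rewrite negb_and -!ltnNge => /orP[] /ncdeg0P[c cE] sub.
      rewrite cE ncconstM; apply: gen_mod_constZ; apply: gr.
      by apply: sub; rewrite !inE eqxx orbT.
    rewrite cE mulr_ncconst; apply: gen_mod_constZ; apply: gl.
    by apply: sub; rewrite !inE eqxx.
have := node_polyE v; move: nsv child; rewrite /nonscalar_product.
case: (label v) => // l r _ sub polyE.
have [|| p [gp1 gp2] gp] := @gen_mod_const_prod ps (node_poly l) (node_poly r).
- by apply: gen; apply: sub; rewrite !inE eqxx.
- by apply: gen; apply: sub; rewrite !inE eqxx orbT.
exists (p :: ps) => //=; split; first by rewrite szE.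
apply: extend; last by rewrite polyE.
by move=> q; rewrite inE orbC => ->.
Qed.

Lemma circuit_rank a b m : (0 < a)%N ->
  (\rank (coef_matrix (circuit_poly C) a b) * m ^ nonscalar_size C
     <= m.+1 ^ (a + nonscalar_size C) + m.+1 ^ (b + nonscalar_size C))%N.
Proof.
move=> a_gt0; have [ps sl [<- gen]] := straight_line_circuit.
have [g gg [c polyE]] := gen (output C).
have decomp_poly : decomp (left_chains ps a) (right_chains ps b) a b
    (fun u v => nccoef (circuit_poly C) (u ++ v)).
  apply: decomp_ext (generated_decomp a b sl gg) => u v su _.
  rewrite /circuit_poly polyE nccoefD {1}/nccoef mcoeffC.
  (* As [a > 0], the word is nonempty, so the constant term of the output does not enter the
     matrix. *)
  suff -> : (FMonom (u ++ v) == mone) = false by rewrite mulr0n add0r.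
  by apply/eqP => /(congr1 (@fdeg _)); rewrite fdeg1 /fdeg /= size_cat su; lia.
apply: leq_trans (leq_mul (decomp_rank decomp_poly) (leqnn _)) _.
rewrite mulnDl; apply: leq_add.
  by have := size_chain m [seq nccoef p.1 | p <- ps] a; rewrite size_map.
by have := size_chain m [seq (fun w => nccoef p.2 (rev w)) | p <- ps] b;
   rewrite size_map.
Qed.

End Circuits.

(** * Numerical estimates and the final bound *)

(* Bernoulli: (1 - 1 / (2 q)) ^ q >= 1 / 2. *)
Lemma bernoulli_half q : (0 < q)%N -> ((2 * q) ^ q <= 2 * (2 * q).-1 ^ q)%N.
Proof.
move=> q_gt0; set m := (2 * q).-1.
have mE : (2 * q = m.+1)%N by rewrite /m; lia.
(* The inequality [(1 - 1 / m.+1) ^ k >= 1 - k / m.+1] with denominators cleared; it is used at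
   [k = q], half of [m.+1]. *)
have bern k : (k <= m.+1 -> m.+1 ^ k * (m.+1 - k) <= m ^ k * m.+1)%N.
  elim: k => [|k IH] lt_km; first by rewrite !expn0 subn0.
  rewrite !expnS -!mulnA.
  apply: leq_trans (leq_mul (leqnn m) (IH (ltnW lt_km))).
  rewrite mulnCA [leqRHS]mulnCA leq_mul2l; apply/orP; right.
  have [j ->] : exists j, m = (k + j)%N by exists (m - k)%N; lia.
  by rewrite subSS addnC addnK -addSn addnK; nia.
have := bern q; rewrite mE; have -> : (m.+1 - q = q)%N by lia.
by rewrite -mE; nia.
Qed.

(** If [s <= a * q], then [m = 2 * q - 1] and Bernoulli give
    [n ^ a <= 2 * (4 * q) ^ a <= (8 * q) ^ a], against [8 * q < n]. *)
Lemma gates_lower_bound n a s q :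
    (0 < a)%N -> (0 < q)%N -> (8 * q < n)%N ->
    (forall m, n ^ a * m ^ s <= 2 * m.+1 ^ (a + s))%N ->
  (a * q < s)%N.
Proof.
move=> a_gt0 q_gt0 q_lt_n upper; rewrite ltnNge; apply/negP => le_s.
set m := (2 * q).-1; have mE : m.+1 = (2 * q)%N by rewrite /m; lia.
have m_gt0 : (0 < m)%N by rewrite /m; lia.
have [t aqE] : exists t, (a * q = s + t)%N by exists (a * q - s)%N; lia.
(* The exponent [s] may be raised to [a * q], since [m ^ t <= m.+1 ^ t]. *)
have step : (n ^ a * m ^ (a * q) <= 2 * (m.+1 ^ a * m.+1 ^ (a * q)))%N.
  rewrite aqE !expnD !mulnA -[(2 * _ * _)%N]mulnA -expnD.
  by apply: leq_mul (upper m) _; case: (t) => // t'; rewrite leq_exp2r.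
have bern : (m.+1 ^ (a * q) <= 2 ^ a * m ^ (a * q))%N.
  rewrite ![(a * q)%N]mulnC !expnM -expnMn leq_exp2r // mE.
  exact: bernoulli_half.
have {step bern} : (n ^ a <= 2 * (4 * q) ^ a)%N.
  have mp : (0 < m ^ (a * q))%N by rewrite expn_gt0 m_gt0.
  rewrite -(leq_pmul2r mp); apply: leq_trans step _.
  rewrite -mulnA leq_mul2l /=.
  apply: leq_trans (leq_mul (leqnn _) bern) _.
  by rewrite mulnA -expnMn mE mulnAC.
apply/negP; rewrite -ltnNge.
apply: (@leq_ltn_trans ((8 * q) ^ a)); last by rewrite ltn_exp2r.
have -> : (8 * q = 2 * (4 * q))%N by lia.
rewrite [in leqRHS]expnMn leq_mul2r; apply/orP; right.
by rewrite -{1}(expn1 2) leq_exp2l.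
Qed.

Theorem theorem1 (R : realType) :
  exists2 gamma : R, 0 < gamma &
    forall (n d : nat) (F : fieldType) (C : circuit F n) (f : ncpoly F n),
      (2 ^ 12 <= n)%N -> (2 <= d)%N -> ~~ odd d ->
      circuit_poly C = f ->
      \rank (coef_matrix f d./2 d./2) = (n ^ d./2)%N ->
      gamma * d%:R * Num.sqrt n%:R <= (nonscalar_size C)%:R.
Proof.
(* The constant 1 suffices: [s > a * q] and [q >= 2 * sqrt n], while [d = 2 * a]. *)
exists 1 => // n d F C f n_ge d_ge2 d_even <- rank_full; rewrite mul1r.
set s := nonscalar_size C; set a := d./2 in rank_full.
have dE : d = (2 * a)%N by rewrite mul2n even_halfK.
have n_big : (4096 <= n)%N := n_ge.
(* The largest [q] with [8 * q < n]. *)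
pose q := ((n - 1) %/ 8)%N.
have aqs : (a * q < s)%N.
  apply: (@gates_lower_bound n); try by rewrite /q; lia.
  move=> m; rewrite -rank_full mul2n -addnn; apply: circuit_rank; lia.
have sqrt_le : 2 * Num.sqrt n%:R <= q%:R :> R.
  rewrite -ler_sqr ?nnegrE ?mulr_ge0 ?sqrtr_ge0 // exprMn sqr_sqrtr //.
  rewrite -!natrX -natrM ler_nat.
  (* After squaring, the claim is [4 * n <= q ^ 2], which follows from [4 * n <= 36 * q] and
     [36 <= q]. *)
  have n_le : (n <= 9 * q)%N by rewrite /q; lia.
  by have q_ge : (36 <= q)%N by [rewrite /q; lia]; nia.
rewrite dE natrM mulrAC mulrC.
apply: le_trans (ler_wpM2l _ sqrt_le) _; first by [].
by rewrite -natrM ler_nat ltnW.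
Qed.
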